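(* Let $k\ge 2$ and let $\Omega\subset\mathbb{R}^k$ be a bounded open set. Let $A\subset\Omega$ be a closed subset of a Lipschitz curve and let $B$ be a closed subset of $\mathbb{R}^k$ such that $B\cap\Omega$ is non-empty. Let $\beta>0$ and let $\psi\colon(\beta,\infty)\to(0,\infty)$ be a concave increasing function such that $\psi(t)\to\infty$ as $t\to\infty$. Fix $\alpha>0$ small enough that the composition $g(t)=(\psi\circ\eta)(t)$ is well-defined on $(0,\alpha)$. Then there exist positive constants $c_1,c_2,\tau$ such that for every subharmonic function $u$ on $\Omega\setminus B$ satisfying $$u(x)\le g(\operatorname{dist}(x,A\cup B)),\qquad x\in\Omega,\ 0<\operatorname{dist}(x,A\cup B)<\alpha,$$ one has $$u(x)\le 2g(c_1\operatorname{dist}(x,B))-g(c_2\operatorname{dist}(x,B)),\qquad x\in\Omega,\ 0<\operatorname{dist}(x,B)<\tau.$$ In particular $c_1,c_2,\tau$ do not depend on $u$.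
   Context: The function $\eta\colon(0,\infty)\to\mathbb{R}$ is $\eta(t)=t^{2-k}$ if $k>2$ and $\eta(t)=\log(1/t)$ if $k=2$. Write $x=(x',x'')\in\mathbb{R}^k$ with $x'\in\mathbb{R}$, $x''\in\mathbb{R}^{k-1}$. For $r,s>0$ put $\mathcal{C}(0,r,s)=(-r,r)\times B_{k-1}(0,s)$, where $B_{k-1}(0,s)$ is the open ball of radius $s$ in $\mathbb{R}^{k-1}$ centered at $0$. For $a\in\mathbb{R}^k$ let $T_a x=x+a$. A Lipschitz curve (1-dimensional Lipschitz surface) is a compact set $\Gamma\subset\mathbb{R}^k$ for which there are constants $L,R>0$ such that for any $a\in\Gamma$ there exist a Lipschitz function $\varphi\colon(-R,R)\to\mathbb{R}^{k-1}$ with Lipschitz constant at most $L$ and a $k\times k$ orthogonal matrix $U_a$ such that $\mathcal{C}(0,R,3LR)\cap U_aT_{-a}\Gamma$ equals the graph of $\varphi$. Subharmonic functions are allowed to take the value $-\infty$. *)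

(* Defs.v *)
From HB Require Import structures.
From mathcomp Require Import all_boot all_order all_algebra.
From mathcomp Require Import all_classical all_reals all_analysis.

Set Implicit Arguments.
Unset Strict Implicit.
Unset Printing Implicit Defensive.

Import Order.TTheory GRing.Theory Num.Theory.
Import numFieldNormedType.Exports.

Local Open Scope classical_set_scope.
Local Open Scope ring_scope.

Section Defs.
Variable R : realType.

(* The library norm on ['rV[R]_n] is the sup norm, so the Euclidean norm is
   defined here.  Both induce the same topology and the same bounded sets. *)
Definition enorm n (x : 'rV[R]_n) : R := Num.sqrt (\sum_(i < n) x 0 i ^+ 2).

Definition eball n (a : 'rV[R]_n) (r : R) : set 'rV[R]_n :=
  [set x | enorm (x - a) < r].

Definition ecball n (a : 'rV[R]_n) (r : R) : set 'rV[R]_n :=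
  [set x | enorm (x - a) <= r].

Definition esphere n (a : 'rV[R]_n) (r : R) : set 'rV[R]_n :=
  [set x | enorm (x - a) = r].

(* Only meaningful for nonempty [S]: [inf set0 = 0]. *)
Definition dist n (x : 'rV[R]_n) (S : set 'rV[R]_n) : R :=
  inf [set enorm (x - y) | y in S].

Definition eta_dim (k : nat) (t : R) : R :=
  if k == 2%N then ln t^-1 else t ^- (k - 2)%N.

(* R^(1+d) is R x R^d, [lsubmx] and [rsubmx] being the two components. *)
Definition cylinder d (r s : R) : set 'rV[R]_(1 + d) :=
  [set x | - r < lsubmx x 0 0 < r /\ eball 0 s (rsubmx x)].

Definition graph_on d (r : R) (phi : R -> 'rV[R]_d) : set 'rV[R]_(1 + d) :=
  [set row_mx t%:M (phi t) | t in `]-r, r[].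

(* Points are row vectors, so the matrix U acts by [y |-> y *m U^T]. *)
Definition lipschitz_curve d (Gamma : set 'rV[R]_(1 + d)) : Prop :=
  compact Gamma /\
  exists L r : R, [/\ 0 < L, 0 < r &
    forall a, Gamma a ->
    exists (phi : R -> 'rV[R]_d) (U : 'M[R]_(1 + d)),
      [/\ forall s t, s \in `]-r, r[ -> t \in `]-r, r[ ->
            enorm (phi s - phi t) <= L * `|s - t|,
          U *m U^T = 1%:M &
          cylinder r (3 * L * r) `&` [set (y - a) *m U^T | y in Gamma]
            = graph_on r phi]].

Definition partial n (i : 'I_n) (h : 'rV[R]_n -> R) : 'rV[R]_n -> R :=
  'D_(delta_mx 0 i) h.

Definition C2_on n (D : set 'rV[R]_n) (h : 'rV[R]_n -> R) : Prop :=
  forall x, D x ->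
  [/\ {for x, continuous h},
      forall i, derivable h x (delta_mx 0 i) /\
                {for x, continuous (partial i h)} &
      forall i j, derivable (partial i h) x (delta_mx 0 j) /\
                  {for x, continuous (partial j (partial i h))}].

Definition harmonic_on n (D : set 'rV[R]_n) (h : 'rV[R]_n -> R) : Prop :=
  C2_on D h /\ forall x, D x -> \sum_(i < n) partial i (partial i h) x = 0.

Definition usc_on n (D : set 'rV[R]_n) (u : 'rV[R]_n -> \bar R) : Prop :=
  forall x, D x -> forall a : R, (u x < a%:E)%E ->
  \forall y \near x, D y -> (u y < a%:E)%E.

(* F. Riesz's definition: values in [-oo, +oo), upper semicontinuity, and
   domination by every harmonic function on a closed ball that dominates [u] on
   the bounding sphere.  Only the values of [u] on [D] matter; [u] identically
   -oo is allowed. *)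
Definition subharmonic_on n (D : set 'rV[R]_n) (u : 'rV[R]_n -> \bar R) : Prop :=
  [/\ forall x, D x -> (u x < +oo)%E,
      usc_on D u &
      forall (a : 'rV[R]_n) (r : R) (h : 'rV[R]_n -> R),
        0 < r -> ecball a r `<=` D ->
        {within ecball a r, continuous h} -> harmonic_on (eball a r) h ->
        (forall x, esphere a r x -> (u x <= (h x)%:E)%E) ->
        forall x, eball a r x -> (u x <= (h x)%:E)%E].

Definition concave_function (I : set R) (f : R -> R) : Prop :=
  @convex_function R R^o I (fun t => - f t).

End Defs.

(* Main.v *)
Require Import Defs.
From HB Require Import structures.
From mathcomp Require Import all_boot all_order all_algebra.
From mathcomp Require Import all_classical all_reals all_analysis.
From mathcomp Require Import ring lra.

Set Implicit Arguments.
Unset Strict Implicit.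
Unset Printing Implicit Defensive.

Import Order.TTheory GRing.Theory Num.Theory.
Import numFieldNormedType.Exports.

Local Open Scope classical_set_scope.
Local Open Scope ring_scope.

(* With c1 = c2 =: c the conclusion reads u(x) <= g(c dist(x, B)), and this is
   what holds.  Concavity replaces psi by a tangent line, so u may be compared
   with affine functions of eta, the fundamental solution of the Laplacian.
   Let delta = dist(x, B) and suppose that x is much closer than delta to some
   point a of A.  In a region about a of size comparable to delta, cut off by
   two hyperplanes transversal to the curve, the boundary stays at distance
   comparable to delta from the curve, except near the two points z1, z2 where
   the curve crosses the hyperplanes; on the hyperplane through z_i the distance
   to the curve is comparable to |y - z_i|.  Hence a constant plus the two poles
   eta(c |y - z1|) + eta(c |y - z2|), which is harmonic in the region, dominates
   u on its boundary, and by the maximum principle it does so at x, where it is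
   at most eta of a multiple of delta. *)

(** * Euclidean norm, balls and distance to a set *)

Section Euclidean.
Context {R : realType} {n : nat}.
Implicit Types (x y z : 'rV[R]_n) (r : R) (S : set 'rV[R]_n).

Definition sqnorm x : R := \sum_(i < n) x 0 i ^+ 2.

Lemma sqnorm_ge0 x : 0 <= sqnorm x.
Proof. by apply: sumr_ge0 => i _; exact: sqr_ge0. Qed.

Lemma enorm_ge0 x : 0 <= enorm x.
Proof. exact: sqrtr_ge0. Qed.

Lemma sqr_enorm x : enorm x ^+ 2 = sqnorm x.
Proof. by rewrite sqr_sqrtr // sqnorm_ge0. Qed.

Lemma enormN x : enorm (- x) = enorm x.
Proof.
by congr Num.sqrt; apply: eq_bigr => i _; rewrite mxE sqrrN.
Qed.

Lemma enormC x y : enorm (x - y) = enorm (y - x).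
Proof. by rewrite -enormN opprB. Qed.

Lemma coord_le_enorm x i : `|x 0 i| <= enorm x.
Proof.
rewrite -sqrtr_sqr; apply: ler_wsqrtr.
by rewrite (bigD1 i) //= lerDl; apply: sumr_ge0 => j _; exact: sqr_ge0.
Qed.

Lemma enorm_eq0 x : enorm x = 0 -> x = 0.
Proof.
move=> x0; apply/rowP => i; rewrite mxE; apply/eqP.
by rewrite -normr_le0 -x0 coord_le_enorm.
Qed.

Lemma enorm0 : enorm (0 : 'rV[R]_n) = 0.
Proof.
rewrite /enorm big1 ?sqrtr0 // => i _.
by rewrite mxE expr0n.
Qed.

Lemma enorm_gt0 x : x != 0 -> 0 < enorm x.
Proof.
move=> x0; rewrite lt_neqAle enorm_ge0 andbT eq_sym.
by apply: contraNN x0 => /eqP/enorm_eq0 ->.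
Qed.

(** Cauchy-Schwarz, by Young's inequality in each coordinate with the weight [c] = |y| / |x|, for
    which the summed bound is exactly |x| |y|. *)
Lemma dot_le_enorm x y : \sum_(i < n) x 0 i * y 0 i <= enorm x * enorm y.
Proof.
have [/eqP/enorm_eq0 ->|x0] := boolP (enorm x == 0).
  by rewrite big1 ?mulr_ge0 ?enorm_ge0 // => i _; rewrite mxE mul0r.
have [/eqP/enorm_eq0 ->|y0] := boolP (enorm y == 0).
  by rewrite big1 ?mulr_ge0 ?enorm_ge0 // => i _; rewrite mxE mulr0.
have xgt : 0 < enorm x by rewrite lt_def x0 enorm_ge0.
have ygt : 0 < enorm y by rewrite lt_def y0 enorm_ge0.
set c := enorm y / enorm x.
have c0 : 0 < c by rewrite divr_gt0.
have H i : x 0 i * y 0 i <= (c / 2) * x 0 i ^+ 2 + (c^-1 / 2) * y 0 i ^+ 2.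
  rewrite -subr_ge0.
  suff -> : (c / 2) * x 0 i ^+ 2 + (c^-1 / 2) * y 0 i ^+ 2 - x 0 i * y 0 i
    = (c^-1 / 2) * (c * x 0 i - y 0 i) ^+ 2.
    by rewrite mulr_ge0 ?sqr_ge0 // divr_ge0 // invr_ge0 ltW.
  by field; lra.
apply: (le_trans (ler_sum _ (fun i _ => H i))).
rewrite big_split /= -!mulr_sumr -/(sqnorm x) -/(sqnorm y) -!sqr_enorm /c.
rewrite le_eqVlt; apply/orP; left; apply/eqP; by field; rewrite x0 y0.
Qed.

Lemma enormD x y : enorm (x + y) <= enorm x + enorm y.
Proof.
rewrite -(@ler_pXn2r _ 2) ?nnegrE ?addr_ge0 ?enorm_ge0 //.
rewrite sqrrD !sqr_enorm.
rewrite /sqnorm.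
have -> : \sum_(i < n) (x + y) 0 i ^+ 2 = \sum_(i < n) x 0 i ^+ 2
   + 2 * \sum_(i < n) x 0 i * y 0 i + \sum_(i < n) y 0 i ^+ 2.
  rewrite mulr_sumr -!big_split /=; apply: eq_bigr => i _.
  by rewrite mxE; ring.
by have := dot_le_enorm x y; rewrite -mulr_natl; lra.
Qed.

Lemma enormB_trans y x z : enorm (x - z) <= enorm (x - y) + enorm (y - z).
Proof. by rewrite -[x - z](subrKA y) enormD. Qed.

Lemma continuous_coordB i z : continuous (fun y => (y - z) 0 i).
Proof.
move=> x; rewrite (_ : (fun y => _) = (fun y => y 0 i - z 0 i)).
  by apply: continuousB; [exact: coord_continuous | exact: cst_continuous].
by apply/funext => y; rewrite !mxE.
Qed.

Lemma continuous_sqnorm z : continuous (fun x => sqnorm (x - z)).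
Proof.
move=> x; apply: (@cvg_big _ _ _ _ _ add_continuous _ (nbhs x)) => i _.
apply: (@continuous_comp _ _ _ (fun y => (y - z) 0 i) (fun t => t ^+ 2)).
  exact: continuous_coordB.
exact: exprn_continuous.
Qed.

Lemma continuous_enorm z : continuous (fun x => enorm (x - z)).
Proof.
move=> x; apply: (@continuous_comp _ _ _ (fun x => sqnorm (x - z)) Num.sqrt).
  exact: continuous_sqnorm.
exact: sqrt_continuous.
Qed.

Lemma normr_le_enorm x : `|x| <= enorm x.
Proof.
rewrite [leLHS]/Num.norm /= mx_normrE; apply/bigmax_leP; split=> [|[i j] _].
  exact: enorm_ge0.
by rewrite /= (ord1 i) coord_le_enorm.
Qed.

Lemma nbhs_eball x r : 0 < r -> nbhs x (eball x r).
Proof.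
move=> r0; have cx : enorm (y - x) @[y --> x] --> enorm (x - x).
  exact: continuous_enorm.
by rewrite subrr enorm0 in cx; exact: (cvgr_lt _ cx r r0).
Qed.

Lemma nbhs_eballP x (P : set 'rV[R]_n) :
  nbhs x P -> exists2 r, 0 < r & ecball x r `<=` P.
Proof.
move=> /nbhs_ballP[e /= e0 eP]; exists (e / 2); first by rewrite divr_gt0.
move=> y /= yx; apply: eP; rewrite mx_norm_ball /ball_ /=.
apply: (le_lt_trans (normr_le_enorm _)); rewrite enormC.
by apply: (le_lt_trans yx); lra.
Qed.

Lemma closed_ecball x r : closed (ecball x r).
Proof.
rewrite (_ : ecball x r = (fun y => enorm (y - x)) @^-1` [set t | t <= r]) //.
by apply: closed_comp => [y _|]; [exact: continuous_enorm | exact: closed_le].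
Qed.

Lemma open_eball x r : open (eball x r).
Proof.
rewrite (_ : eball x r = (fun y => enorm (y - x)) @^-1` [set t | t < r]) //.
by apply: open_comp => [y _|]; [exact: continuous_enorm | exact: open_lt].
Qed.

Lemma compact_ecball x r : compact (ecball x r).
Proof.
apply: bounded_closed_compact; last exact: closed_ecball.
exists (r + `|x|); split; first exact: num_real.
move=> M ltM y /= yr; rewrite -[y](subrK x); apply: (le_trans (ler_normD _ _)).
apply: le_trans (ltW ltM); rewrite lerD2r.
exact: le_trans (normr_le_enorm _) yr.
Qed.

Lemma dist_le x y S : S y -> dist x S <= enorm (x - y).
Proof.
move=> Sy; apply: ge_inf; last by exists y.
by exists 0 => _ [z _ <-]; exact: enorm_ge0.
Qed.

Lemma dist_ge x S r : S !=set0 -> (forall y, S y -> r <= enorm (x - y)) ->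
  r <= dist x S.
Proof.
move=> [y Sy] rS; apply: lb_le_inf; first by exists (enorm (x - y)); exists y.
by move=> _ [z Sz <-]; exact: rS.
Qed.

End Euclidean.

(** A radius good at [a] serves, once halved, for all points near [a]; compactness in its
    near-covering form makes the choice uniform as the radius tends to 0 from the right. *)
Lemma compact_thickening {R : realType} {n : nat} (A O : set 'rV[R]_n) :
  compact A -> open O -> A `<=` O ->
  exists2 r : R, 0 < r & forall a, A a -> ecball a r `<=` O.
Proof.
move=> /compact_near_coveringP Ac Oo AO.
have [] := Ac R (0 : R)^'+ (fun r a => ecball a r `<=` O) _.
  move=> a Aa; have /nbhs_eballP[r r0 rO] : nbhs a O by apply: Oo; exact: AO.
  have r20 : 0 < r / 2 by rewrite divr_gt0.
  near=> b e => y /= yb; apply: rO => /=.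
  apply: (le_trans (enormB_trans b _ _)).
  have : enorm (b - a) < r / 2.
    by near: b; exact: nbhs_eball.
  have : e < r / 2 by near: e; exact: nbhs_right_lt.
  have : enorm (y - b) <= e by [].
  by lra.
move=> e /= e0 H; exists (e / 2); first by rewrite divr_gt0.
apply: H => /=; last by rewrite divr_gt0.
by rewrite sub0r normrN gtr0_norm ?divr_gt0 //; lra.
Unshelve. all: by end_near. Qed.

(** * Harmonic functions through explicit derivatives: affine and radial ones *)

Section HarmonicJets.
Context {R : realType} {n : nat}.
Implicit Types (D : set 'rV[R]_n) (x y z : 'rV[R]_n).

Local Notation e i := (delta_mx 0 i : 'rV[R]_n).

(* Explicit candidates [h1], [h2] for the first and second partial derivatives
   make sums and scalar multiples of harmonic functions easy to handle. *)
Definition harmonic_jet D (h : 'rV[R]_n -> R) (h1 : 'I_n -> 'rV[R]_n -> R)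
    (h2 : 'I_n -> 'I_n -> 'rV[R]_n -> R) : Prop :=
  forall x, D x ->
  [/\ {for x, continuous h},
      forall i, is_derive x (e i) h (h1 i x) /\ {for x, continuous (h1 i)},
      forall i j, is_derive x (e j) (h1 i) (h2 i j x) /\
                  {for x, continuous (h2 i j)} &
      \sum_(i < n) h2 i i x = 0].

Lemma near_eq_continuous_for (h g : 'rV[R]_n -> R) x :
  (\near x, h x = g x) -> {for x, continuous h} -> {for x, continuous g}.
Proof.
move=> hg ch; have hgx : h x = g x by exact: nbhs_singleton hg.
have ch1 : h @ x --> h x by exact: ch.
have : g @ x --> h x by exact: cvg_trans (near_eq_cvg hg) ch1.
by rewrite hgx.
Qed.

(** Since [D] is open, the candidates agree with the partial derivatives near each point of [D], so
    derivability and continuity pass from the former to the latter. *)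
Lemma harmonic_of_jet D h h1 h2 :
  open D -> harmonic_jet D h h1 h2 -> harmonic_on D h.
Proof.
move=> Do jh.
have P1 i x : D x -> partial i h x = h1 i x.
  by move=> Dx; have [_ /(_ i)[? _] _ _] := jh x Dx; exact: derive_val.
have N1 i x : D x -> \near x, h1 i x = partial i h x.
  by move=> Dx; near=> y; rewrite P1 //; near: y; exact: Do.
have P2 i j x : D x -> partial j (partial i h) x = h2 i j x.
  move=> Dx; have [_ _ /(_ i j)[d _] _] := jh x Dx.
  have ? := near_eq_is_derive (N1 i x Dx) d; exact: derive_val.
have N2 i j x : D x -> \near x, h2 i j x = partial j (partial i h) x.
  by move=> Dx; near=> y; rewrite P2 //; near: y; exact: Do.
split=> [x Dx|x Dx].
  have [ch J1 J2 _] := jh x Dx; split=> // [i|i j].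
    have [d1 c1] := J1 i; split; first by case: d1.
    exact: near_eq_continuous_for (N1 i x Dx) c1.
  have [d2 c2] := J2 i j; split.
    by have [] := near_eq_is_derive (N1 i x Dx) d2.
  exact: near_eq_continuous_for (N2 i j x Dx) c2.
have [_ _ _] := jh x Dx; apply: etrans; apply: eq_bigr => i _; exact: P2.
Unshelve. all: by end_near. Qed.

Lemma harmonic_jetD D h h1 h2 g g1 g2 :
  harmonic_jet D h h1 h2 -> harmonic_jet D g g1 g2 ->
  harmonic_jet D (h + g) (fun i => h1 i + g1 i) (fun i j => h2 i j + g2 i j).
Proof.
move=> jh jg x Dx; have [ch H1 H2 Hs] := jh x Dx; have [cg G1 G2 Gs] := jg x Dx.
split=> [|i|i j|].
- exact: continuousD.
- have [d1 c1] := H1 i; have [d1' c1'] := G1 i; split; last exact: continuousD.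
  exact: is_deriveD.
- have [d1 c1] := H2 i j; have [d1' c1'] := G2 i j.
  by split; [exact: is_deriveD | exact: continuousD].
- by rewrite big_split /= Hs Gs addr0.
Qed.

Lemma harmonic_jetZ D (c : R) h h1 h2 :
  harmonic_jet D h h1 h2 ->
  harmonic_jet D (fun x => c * h x) (fun i x => c * h1 i x)
    (fun i j x => c * h2 i j x).
Proof.
move=> jh x Dx; have [ch H1 H2 Hs] := jh x Dx.
have cZ (f : 'rV[R]_n -> R) : {for x, continuous f} ->
    {for x, continuous (fun y => c * f y)}.
  by move=> cf; apply: continuousM => //; exact: cst_continuous.
split=> [|i|i j|].
- exact: cZ.
- have [d1 c1] := H1 i; split; last exact: cZ.
  exact: (@is_deriveZ _ _ _ h c).
- have [d1 c1] := H2 i j; split; last exact: cZ.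
  exact: (@is_deriveZ _ _ _ (h1 i) c).
- by rewrite -mulr_sumr Hs mulr0.
Qed.

Lemma harmonic_jetS D D' h h1 h2 : D' `<=` D ->
  harmonic_jet D h h1 h2 -> harmonic_jet D' h h1 h2.
Proof. by move=> DD jh x /DD; exact: jh. Qed.

(** Reduces derivatives along [v] to one real variable: the two difference quotients are the same
    function. *)
Lemma derive_line (h : 'rV[R]_n -> R) x v :
  'D_v h x = 'D_1 (fun t : R => h (t *: v + x)) 0.
Proof.
rewrite /derive; set g1 := fun t => t^-1 *: _; set g2 := fun t => t^-1 *: _.
suff -> : g1 = g2 by [].
by apply/funext => t; rewrite /g1 /g2 /= addr0 scale0r add0r [_%:A]mulr1.
Qed.

Lemma is_derive_line (h : 'rV[R]_n -> R) x v (l : R) :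
  is_derive (0 : R) 1 (fun t : R => h (t *: v + x)) l -> is_derive x v h l.
Proof.
move=> [d0 dl]; have d1 := (derivable1P h x v).2 d0.
by apply: DeriveDef => //; rewrite -dl derive_line.
Qed.

Lemma is_derive_coord i j z x :
  is_derive x (e j) (fun y => (y - z) 0 i) (i == j)%:R.
Proof.
apply: is_derive_line.
rewrite (_ : (fun t => _) = (fun t : R => (i == j)%:R * t) + cst ((x - z) 0 i)).
  have d1 : is_derive (0 : R) 1 (fun t : R => (i == j)%:R * t) ((i == j)%:R * 1).
    exact: (@is_deriveZ _ _ _ id).
  by apply: is_derive_eq; rewrite mulr1 addr0.
by apply/funext => t; rewrite /cst /= !mxE eqxx /= mulrC addrA.
Qed.

Lemma harmonic_jet_affine D z (b : R) (a : 'rV[R]_n) :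
  harmonic_jet D (fun y => b + \sum_(i < n) a 0 i * (y - z) 0 i)
    (fun i => cst (a 0 i)) (fun _ _ => cst 0).
Proof.
move=> x Dx; split=> [|i|i j|].
- apply: continuousD; first exact: cst_continuous.
  apply: (@cvg_big _ _ _ _ _ add_continuous _ (nbhs x)) => i _.
  by apply: continuousM; [exact: cst_continuous | exact: continuous_coordB].
- split; last exact: cst_continuous.
  have d2 : is_derive x (e i) (\sum_(k < n) (fun y => a 0 k * (y - z) 0 k))
      (\sum_(k < n) a 0 k * (k == i)%:R).
    apply: is_derive_sum => k; apply: (@is_deriveZ _ _ _ (fun y => (y - z) 0 k)).
    exact: is_derive_coord.
  have -> : (fun y => b + \sum_(k < n) a 0 k * (y - z) 0 k) =
            cst b + \sum_(k < n) (fun y => a 0 k * (y - z) 0 k).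
    by apply/funext => y; rewrite /cst /= fct_sumE.
  apply: is_derive_eq; rewrite add0r (bigD1 i) //= eqxx mulr1 big1 ?addr0 //.
  by move=> k /negbTE ->; rewrite mulr0.
- by split; [exact: is_derive_cst | exact: cst_continuous].
- by rewrite big1.
Qed.

Lemma harmonic_jet_cst D (b : R) :
  harmonic_jet D (cst b) (fun _ => cst 0) (fun _ _ => cst 0).
Proof.
move=> x Dx; split=> [|i|i j|]; first exact: cst_continuous.
- by split; [exact: is_derive_cst | exact: cst_continuous].
- by split; [exact: is_derive_cst | exact: cst_continuous].
- by rewrite big1.
Qed.

Lemma is_derive_sqnorm i z x :
  is_derive x (e i) (fun y => sqnorm (y - z)) (2 * (x - z) 0 i).
Proof.
have d2 : is_derive x (e i) (\sum_(k < n) (fun y => (y - z) 0 k) ^+ 2)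
    (\sum_(k < n) (2%:R * (x - z) 0 k ^+ 1) *: (k == i)%:R).
  by apply: is_derive_sum => k; apply: is_deriveX; exact: is_derive_coord.
have -> : (fun y => sqnorm (y - z)) = \sum_(k < n) (fun y => (y - z) 0 k) ^+ 2.
  by apply/funext => y; rewrite /sqnorm fct_sumE.
apply: is_derive_eq; rewrite (bigD1 i) //= eqxx big1 ?addr0 => [|k /negbTE ->].
  by rewrite [_ *: 1]mulr1 expr1.
by rewrite scaler0.
Qed.

Lemma is_derive_comp_scalar (G : R -> R) (f : 'rV[R]_n -> R) x v (a b : R) :
  is_derive (f x) 1 G a -> is_derive x v f b ->
  is_derive x v (fun y => G (f y)) (a * b).
Proof.
move=> dG df; apply: is_derive_line.
apply: (@is_derive1_comp _ G (fun t => f (t *: v + x))).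
  by rewrite scale0r add0r.
case: df => d1 d2; have d3 := (derivable1P f x v).1 d1.
by apply: DeriveDef => //; rewrite -d2 derive_line.
Qed.

(** With the squared distance q as radial variable, the Laplacian is 2 (n F1 + 2 q F2), so the last
    hypothesis is the radial Laplace equation. *)
Lemma harmonic_jet_radial z (F F1 F2 : R -> R) :
  (forall q : R, 0 < q -> is_derive q 1 F (F1 q)) ->
  (forall q : R, 0 < q -> is_derive q 1 F1 (F2 q)) ->
  (forall q : R, 0 < q -> {for q, continuous F2}) ->
  (forall q : R, 0 < q -> n%:R * F1 q + 2 * q * F2 q = 0) ->
  harmonic_jet [set x | x != z] (fun x => F (sqnorm (x - z)))
    (fun i x => 2 * (x - z) 0 i * F1 (sqnorm (x - z)))
    (fun i j x => 2 * (i == j)%:R * F1 (sqnorm (x - z)) +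
       4 * (x - z) 0 i * (x - z) 0 j * F2 (sqnorm (x - z))).
Proof.
move=> dF dF1 cF2 eqF x /= xz; set q := sqnorm (x - z).
have q0 : 0 < q by rewrite /q -sqr_enorm exprn_gt0 // enorm_gt0 // subr_eq0.
have cq (G : R -> R) : {for q, continuous G} ->
    {for x, continuous (fun y => G (sqnorm (y - z)))}.
  by move=> cG; apply: continuous_comp => //; exact: continuous_sqnorm.
have cd (G : R -> R) (l : R) : is_derive q 1 G l -> {for q, continuous G}.
  by move=> [/derivable1_diffP/differentiable_continuous].
have c0 := cq F (cd _ _ (dF q q0)); have c1 := cq F1 (cd _ _ (dF1 q q0)).
have c2 := cq F2 (cF2 q q0).
have ca i (a : R) : {for x, continuous (fun y => a * (y - z) 0 i)}.
  by apply: continuousM; [exact: cst_continuous | exact: continuous_coordB].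
split=> [|i|i j|].
- exact: c0.
- split; last exact: continuousM.
  rewrite mulrC; apply: is_derive_comp_scalar; first exact: dF.
  exact: is_derive_sqnorm.
- split; last first.
    apply: continuousD.
      by apply: continuousM => //; exact: cst_continuous.
    by apply: continuousM => //; apply: continuousM => //; exact: continuous_coordB.
  have dl : is_derive x (e j) (fun y => 2 * (y - z) 0 i) (2 * (i == j)%:R).
    by apply: (@is_deriveZ _ _ _ (fun y => (y - z) 0 i)); exact: is_derive_coord.
  have dr : is_derive x (e j) (fun y => F1 (sqnorm (y - z)))
      (F2 q * (2 * (x - z) 0 j)).
    by apply: is_derive_comp_scalar; [exact: dF1 | exact: is_derive_sqnorm].
  apply: (is_derive_eq (is_deriveM dl dr)).
  by rewrite /q /GRing.scale /=; ring.
- have -> : \sum_(i < n) (2 * (i == i)%:R * F1 q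
      + 4 * (x - z) 0 i * (x - z) 0 i * F2 q) =
      \sum_(i < n) 2 * F1 q + \sum_(i < n) (4 * F2 q) * (x - z) 0 i ^+ 2.
    by rewrite -big_split /=; apply: eq_bigr => i _; rewrite eqxx mulr1; ring.
  rewrite sumr_const card_ord -mulr_sumr -/(sqnorm _) -/q -mulr_natl.
  by rewrite -[RHS](mulr0 2) -(eqF q q0); ring.
Qed.

End HarmonicJets.

(** * Semicontinuity and the maximum principle *)

(** The superlevel sets of [f] at its own values form a filter base. A cluster point [p] of it is a
    maximum: if [f p < f q], semicontinuity would separate [p] from the superlevel set of [q]. *)
Lemma usc_attains_max {R : realType} {T : topologicalType} (K : set T)
    (f : T -> \bar R) :
  compact K -> K !=set0 ->
  (forall x q, K x -> K q -> (f x < f q)%E ->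
     \forall y \near x, K y -> (f y < f q)%E) ->
  exists2 p, K p & forall y, K y -> (f y <= f p)%E.
Proof.
move=> Kc [x0 Kx0] usc.
pose G := filter_from K (fun q => [set y | K y /\ (f q <= f y)%E]).
have GF : ProperFilter G.
  apply: filter_from_proper; last by move=> q Kq; exists q.
  apply: filter_from_filter; first by exists x0.
  move=> q1 q2 K1 K2; have [le12|/ltW le21] := leP (f q1) (f q2).
    exists q2 => // y [Ky fy]; do 2!split=> //; exact: le_trans fy.
  exists q1 => // y [Ky fy]; do 2!split=> //; exact: le_trans fy.
have GK : G K by exists x0 => // y [].
have [p [Kp clp]] := Kc G GF GK.
exists p => // q Kq; rewrite leNgt; apply/negP => fpq.
have Gq : G [set y | K y /\ (f q <= f y)%E] by exists q.
have [y [[Ky fqy] /(_ Ky)]] := clp _ _ Gq (usc p q Kp Kq fpq).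
by rewrite ltNge fqy.
Qed.

Lemma continuous_attains_max {R : realType} {T : topologicalType} (K : set T)
    (f : T -> R) :
  compact K -> K !=set0 -> (forall x, K x -> {for x, continuous f}) ->
  exists2 p, K p & forall y, K y -> f y <= f p.
Proof.
move=> Kc K0 fc; have [|p Kp H] := @usc_attains_max R T K (EFin \o f) Kc K0.
  move=> x q Kx _ /=; rewrite lte_fin => fxq.
  have cx : f y @[y --> x] --> f x by exact: fc.
  have Nf : \forall y \near x, f y < f q by exact: (cvgr_lt _ cx _ fxq).
  by near=> y => _; rewrite lte_fin; near: y.
by exists p => // y Ky; have := H y Ky; rewrite /= lee_fin.
Unshelve. all: by end_near. Qed.

Section MaximumPrinciple.
Context {R : realType} {n : nat}.
Implicit Types (D K V : set 'rV[R]_n) (u : 'rV[R]_n -> \bar R).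

Lemma sqnormD_expand (p y : 'rV[R]_n) :
  sqnorm y = sqnorm p + 2 * \sum_(i < n) p 0 i * (y - p) 0 i + sqnorm (y - p).
Proof.
rewrite /sqnorm mulr_sumr -!big_split /=; apply: eq_bigr => i _.
by rewrite !mxE; ring.
Qed.

Lemma usc_add_continuous D K u (w : 'rV[R]_n -> R) x q :
  subharmonic_on D u -> K `<=` D -> {for x, continuous w} ->
  K x -> K q -> (u x + (w x)%:E < u q + (w q)%:E)%E ->
  \forall y \near x, K y -> (u y + (w y)%:E < u q + (w q)%:E)%E.
Proof.
move=> [u_fin u_usc _] KD cw Kx Kq fxq.
have uq := u_fin q (KD q Kq); have ux := u_fin x (KD x Kx).
have [b ub] : exists b : R, (u q + (w q)%:E = b%:E)%E.
  case: (u q) uq fxq => [r _ _|uq _|_ fxq].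
  - by exists (r + w q).
  - by rewrite ltxx in uq.
  - by move: fxq; rewrite addNye ltNge leNye.
rewrite ub in fxq *.
(* The gap between [u x + w x] and [b] is shared between the semicontinuity of [u] and the
   continuity of [w]: half each if [u x] is finite; if it is -oo, [e = 1] will do. *)
have [a [e [e0 ua ab]]] : exists a e : R,
    [/\ 0 < e, (u x < a%:E)%E & a + w x + e <= b].
  case: (u x) ux fxq => [r _|ux _|_ _].
  - rewrite -EFinD lte_fin => rb; exists (r + (b - r - w x) / 2).
    by exists ((b - r - w x) / 2); split; rewrite ?lte_fin; lra.
  - by rewrite ltxx in ux.
  - by exists (b - w x - 1), 1; split; rewrite ?ltNyr //; lra.
have cx : w y @[y --> x] --> w x by exact: cw.
have wx : w x < w x + e by lra.
have N1 : \forall y \near x, w y < w x + e by exact: (cvgr_lt _ cx _ wx).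
have N2 := u_usc x (KD x Kx) a ua.
near=> y => Ky; have wy : w y < w x + e by near: y.
have : (u y < a%:E)%E by apply: (near N2 y) => //; exact: KD.
case: (u y) => [r|ya|_].
- by rewrite -EFinD !lte_fin => ra; lra.
- by rewrite ltNge leey in ya.
- by rewrite addNye ltNyr.
Unshelve. all: by end_near. Qed.

(* Riesz's definition of subharmonicity only concerns balls.  If [u - s] had a
   positive supremum, then for small [eps > 0] the function
   [u - s + eps |y|^2] would attain its maximum at some [p] in [V]; on a small
   sphere about [p] of radius [r], [eps |y|^2] is an affine function plus
   [eps r^2], so that [u] is below the harmonic function [s] plus an affine
   function whose value at [p] is [u p - eps r^2]. *)
Lemma maximum_principle D K V u s s1 s2 :
  subharmonic_on D u -> compact K -> K `<=` D -> open V -> V `<=` K ->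
  (forall x, K x -> {for x, continuous s}) -> harmonic_jet V s s1 s2 ->
  (forall x, K x -> ~ V x -> (u x <= (s x)%:E)%E) ->
  forall x, K x -> (u x <= (s x)%:E)%E.
Proof.
move=> u_sub Kc KD Vo VK s_cont s_harm us y0 Ky0.
rewrite leNgt; apply/negP => suy0.
have [u_fin _ riesz] := u_sub.
have csq (y : 'rV[R]_n) : {for y, continuous (@sqnorm R n)}.
  have := @continuous_sqnorm R n 0 y.
  by rewrite (_ : (fun x => _) = @sqnorm R n) //; apply/funext => x; rewrite subr0.
have K0 : K !=set0 by exists y0.
have [pc Kpc Cmax] := continuous_attains_max Kc K0 (fun y _ => csq y).
set C := sqnorm pc in Cmax; have C0 : 0 <= C by exact: sqnorm_ge0.
have [uy0 uy0E] : exists r : R, u y0 = r%:E.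
  move: (u_fin y0 (KD y0 Ky0)) suy0.
  by case: (u y0) => [r||] //; exists r.
rewrite uy0E lte_fin in suy0.
(* On [K] the term [e * sqnorm y] is at most [e * C], which is less than the excess of [u] over [s]
   at [y0]. So the perturbed maximum cannot be attained at a point of [K] outside [V], because [u]
   is at most [s] there. *)
pose e := (uy0 - s y0) / (C + 1).
have e0 : 0 < e by rewrite divr_gt0 //; lra.
have eC : e * (C + 1) = uy0 - s y0 by rewrite /e divfK //; lra.
pose w y := e * sqnorm y - s y.
have cw y : K y -> {for y, continuous w}.
  move=> Ky; apply: continuousB; last exact: s_cont.
  by apply: continuousM => //; exact: cst_continuous.
have [|p Kp pmax] := @usc_attains_max R _ K (fun y => u y + (w y)%:E)%E Kc K0.
  move=> x q Kx Kq; exact: (usc_add_continuous u_sub KD (cw x Kx)).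
have := pmax y0 Ky0; rewrite uy0E -EFinD.
have [up upE] : exists r : R, u p = r%:E.
  move: (u_fin p (KD p Kp)) (pmax y0 Ky0); rewrite uy0E -EFinD.
  by case: (u p) => [r||] //; exists r.
rewrite upE -EFinD lee_fin => pmax0.
have sq0 := sqnorm_ge0 y0.
have Vp : V p.
  apply: contrapT => nVp; have := us p Kp nVp; rewrite upE lee_fin => usp.
  have : e * sqnorm p <= e * C by rewrite ler_pM2l // Cmax.
  have : 0 <= e * sqnorm y0 by rewrite mulr_ge0 // ltW.
  by move: pmax0; rewrite /w; nra.
have [r r0 rV] := nbhs_eballP (Vo p Vp).
pose b := up - s p - e * r ^+ 2.
pose h := s + (fun y => b + \sum_(i < n) ((- (2 * e)) *: p) 0 i * (y - p) 0 i).
have hj := harmonic_jetD s_harm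
  (@harmonic_jet_affine R n V p b ((- (2 * e)) *: p)).
have hE y : h y = s y + up - s p - e * r ^+ 2
    - e * (sqnorm y - sqnorm p - sqnorm (y - p)).
  rewrite /h /b /= [in RHS](sqnormD_expand p y).
  have -> : (s + (fun y => up - s p - e * r ^+ 2
      + \sum_(i < n) (- (2 * e) *: p) 0 i * (y - p) 0 i)) y
    = s y + (up - s p - e * r ^+ 2
      + \sum_(i < n) (- (2 * e) *: p) 0 i * (y - p) 0 i) by [].
  have -> : \sum_(i < n) (- (2 * e) *: p) 0 i * (y - p) 0 i
     = - (2 * e) * \sum_(i < n) p 0 i * (y - p) 0 i.
    by rewrite mulr_sumr; apply: eq_bigr => i _; rewrite mxE -mulrA.
  by ring.
have hp : h p = up - e * r ^+ 2.
  have -> : h p = s p + up - s p - e * r ^+ 2 - e * (0 - sqnorm (p - p)).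
    by rewrite hE subrr.
  by rewrite -sqr_enorm subrr enorm0; ring.
have ecV : eball p r `<=` V by move=> y /ltW; exact: rV.
have : (u p <= (h p)%:E)%E.
  apply: (riesz p r h) => //.
  - by move=> y /rV /VK /KD.
  - apply: continuous_in_subspaceT => y /set_mem /rV Vy.
    by have [] := hj y Vy.
  - by apply: harmonic_of_jet (harmonic_jetS ecV hj); exact: open_eball.
  - move=> y yr; have Ky : K y by apply/VK/rV; rewrite /ecball /= yr.
    have := pmax y Ky; rewrite upE -EFinD.
    case: (u y) => [t||] //; rewrite ?leNye // -EFinD !lee_fin hE /w.
    by rewrite -(sqr_enorm (y - p)) yr; lra.
  - by rewrite /eball /= subrr enorm0.
rewrite upE hp lee_fin; have : 0 < e * r ^+ 2 by rewrite mulr_gt0 // exprn_gt0.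
by lra.
Qed.

End MaximumPrinciple.

(** * The fundamental solution of the Laplacian *)

Section FundamentalSolution.
Context {R : realType} {k : nat} (k_ge2 : (2 <= k)%N).
Implicit Types (a b c e r s t : R).

Lemma eta_dim_le s t : 0 < s -> s <= t -> eta_dim k t <= eta_dim k s.
Proof.
move=> s0 st; have t0 : 0 < t by exact: lt_le_trans st.
rewrite /eta_dim; case: ifP => _.
  by rewrite ler_ln ?posrE ?invr_gt0 // lef_pV2 ?posrE.
by rewrite lef_pV2 ?posrE ?exprn_gt0 // lerXn2r // nnegrE ltW.
Qed.

Lemma eta_dim_blowup (M : R) :
  exists2 r, 0 < r & forall t, 0 < t -> t <= r -> M <= eta_dim k t.
Proof.
rewrite /eta_dim; have [k2|k2] := eqVneq k 2%N.
  exists (expR (- M)); first exact: expR_gt0.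
  move=> t t0 tM; rewrite lnV ?posrE // lerNr -(expRK (- M)).
  by rewrite ler_ln ?posrE ?expR_gt0.
have M0 : 0 < `|M| + 1 by have := normr_ge0 M; lra.
(* This radius is at most 1, so that t^(k-2) <= t and eta is at least 1/t. *)
exists (`|M| + 1)^-1; first by rewrite invr_gt0.
move=> t t0 tM; have t1 : t <= 1.
  by apply: (le_trans tM); rewrite invf_le1 //; have := normr_ge0 M; lra.
have tp : t ^+ (k - 2) <= t.
  have [m ->] : exists m, (k - 2)%N = m.+1.
    by exists (k - 3)%N; rewrite subnSK // ltn_neqAle eq_sym k2.
  rewrite exprS; apply: ler_piMr; first exact: ltW.
  by rewrite exprn_ile1 // ltW.
have Mt : M <= t^-1.
  apply: (@le_trans _ _ (`|M| + 1)); first by have := ler_norm M; lra.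
  by rewrite -[leLHS]invrK lef_pV2 ?posrE ?invr_gt0.
by apply: (le_trans Mt); rewrite lef_pV2 ?posrE ?exprn_gt0.
Qed.

(** Turns the two-pole bound into a single value of eta. For k = 2 the coefficients add up to 1 and
    the logarithms merge into one, with [e] = c (a/b)^2. For k > 2 the term in [b] is dropped, and
    three copies of the larger of the other two powers are absorbed by dividing the argument by 3,
    as 3 <= 3^(k-2). *)
Lemma eta_dim_combine a b c : 0 < a -> 0 < b -> 0 < c ->
  exists2 e, 0 < e & forall r, 0 < r ->
    2 * (eta_dim k (a * r) - eta_dim k (b * r)) + eta_dim k (c * r)
      <= eta_dim k (e * r).
Proof.
move=> a0 b0 c0; rewrite /eta_dim; have [k2|k2] := eqVneq k 2%N.
  exists (c * (a / b) ^+ 2); first by rewrite mulr_gt0 // exprn_gt0 // divr_gt0.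
  move=> r r0; rewrite !lnV ?posrE ?mulr_gt0 ?exprn_gt0 ?invr_gt0 //.
  rewrite !lnM ?posrE ?mulr_gt0 ?exprn_gt0 ?invr_gt0 //.
  by rewrite lnV ?posrE //; lra.
set p := (k - 2)%N.
have p1 : (1 <= p)%N by rewrite /p subn_gt0 ltn_neqAle eq_sym k2.
pose m := Num.min a c; have m0 : 0 < m by rewrite lt_min a0.
exists (m / 3); first by rewrite divr_gt0.
move=> r r0; have mr0 : 0 < m * r by rewrite mulr_gt0.
have H x : m <= x -> (x * r) ^- p <= (m * r) ^- p.
  move=> mx; have x0 : 0 < x by exact: lt_le_trans mx.
  rewrite lef_pV2 ?posrE ?exprn_gt0 ?mulr_gt0 //.
  by rewrite lerXn2r ?nnegrE ?(ltW (mulr_gt0 _ _)) // ler_pM2r.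
have Ha : (a * r) ^- p <= (m * r) ^- p by apply: H; rewrite ge_min lexx.
have Hc : (c * r) ^- p <= (m * r) ^- p by apply: H; rewrite ge_min lexx orbT.
have Hb : 0 <= (b * r) ^- p by rewrite invr_ge0 exprn_ge0 // mulr_ge0 // ltW.
have H3 : 3 * (m * r) ^- p <= (m / 3 * r) ^- p.
  have -> : m / 3 * r = (m * r) / 3 by ring.
  rewrite expr_div_n invf_div.
  apply: ler_wpM2r; first by rewrite invr_ge0 exprn_ge0 // ltW.
  by rewrite -[leLHS]expr1; apply: ler_weXn2l => //; lra.
by apply: le_trans H3; lra.
Qed.

(** In both cases of the definition the derivative is a multiple of the same power of q, so
    harmonicity can be checked at once for all k. *)
Lemma is_derive_eta_dim_sqrt c : 0 < c ->
  exists C : R, forall q : R, 0 < q ->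
    is_derive q 1 (fun q => eta_dim k (c * Num.sqrt q))
      (C * q `^ (- (k%:R / 2))).
Proof.
move=> c0; rewrite /eta_dim; have [k2|k2] := eqVneq k 2%N.
  exists (- 2^-1) => q q0.
  have E : \near q, - ln c + - 2^-1 * ln q = ln (c * Num.sqrt q)^-1.
    near=> x; have x0 : 0 < x by near: x; exact: lt_nbhsr.
    rewrite lnV ?posrE ?mulr_gt0 ?sqrtr_gt0 // lnM ?posrE ?sqrtr_gt0 //.
    by rewrite -powR12_sqrt ?ltW // ln_powR; ring.
  apply: (near_eq_is_derive E).
  have d1 : is_derive q 1 (fun x => - 2^-1 * ln x) (- 2^-1 * q^-1).
    by apply: (@is_deriveZ _ _ _ (@ln R)); exact: is_derive1_ln.
  have d2 := is_deriveD (is_derive_cst (- ln c) q 1) d1.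
  apply: (is_derive_eq d2); rewrite add0r k2; congr (_ * _).
  by rewrite divff // powR_inv1 // ltW.
set p := (k - 2)%N.
exists (c ^- p * (- (p%:R / 2))) => q q0.
have E : \near q, c ^- p * q `^ (- (p%:R / 2)) = (c * Num.sqrt q) ^- p.
  near=> x; have x0 : 0 < x by near: x; exact: lt_nbhsr.
  rewrite exprMn invfM; congr (_ * _).
  rewrite -powR12_sqrt ?ltW // powRN; congr (_^-1).
  by rewrite -powR_mulrn ?powR_ge0 // -powRrM mulrC.
apply: (near_eq_is_derive E).
have d1 := is_derive1_powR (- (p%:R / 2)) q0.
have d2 := is_deriveZ (c ^- p) d1.
apply: (is_derive_eq d2); rewrite /GRing.scale /= mulrA; congr (_ * _ `^ _).
by rewrite /p natrB //; lra.
Unshelve. all: by end_near. Qed.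

(** With F1 = C q^(-k/2) one has 2 q F2 = -k F1, the equation required by [harmonic_jet_radial]. *)
Lemma eta_dim_harmonic c (z : 'rV[R]_k) : 0 < c ->
  exists h1 h2, harmonic_jet [set x | x != z]
    (fun x => eta_dim k (c * enorm (x - z))) h1 h2.
Proof.
move=> c0; have [C dF] := is_derive_eta_dim_sqrt c0.
pose F1 (q : R) := C * q `^ (- (k%:R / 2)).
pose F2 (q : R) := C * (- (k%:R / 2) * q `^ (- (k%:R / 2) - 1)).
have dF1 (q : R) : 0 < q -> is_derive q 1 F1 (F2 q).
  by move=> q0; have := is_deriveZ C (is_derive1_powR (- (k%:R / 2)) q0).
do 2!eexists; apply: (harmonic_jet_radial dF dF1) => q q0.
  have d2 := is_deriveZ (C * - (k%:R / 2))
    (is_derive1_powR (- (k%:R / 2) - 1) q0).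
  have -> : F2 = (C * - (k%:R / 2)) \*: (fun x => x `^ (- (k%:R / 2) - 1)).
    by apply/funext => x; rewrite /F2 /= /GRing.scale /= mulrA.
  by case: d2 => /derivable1_diffP/differentiable_continuous.
rewrite /F1 /F2 powRB ?(gt_eqF q0) ?implybT // powRr1 ?ltW //.
by field; rewrite gt_eqF.
Qed.

End FundamentalSolution.

(** * Concave functions, and comparison with two poles *)

Lemma concave_three_points {R : realType} (I : set R) (f : R -> R) (a b c : R) :
  concave_function I f -> I a -> I c -> a < b -> b < c ->
  (c - b) * f a + (b - a) * f c <= (c - a) * f b.
Proof.
move=> fI Ia Ic ab bc; have ca : 0 < c - a by lra.
pose t := (c - b) / (c - a).
have t01 : 0 <= t <= 1.
  by rewrite divr_ge0 ?ler_pdivrMr //=; lra.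
pose T : {i01 R} := Itv01 (andP t01).1 (andP t01).2.
have H : - f (t * a + (1 - t) * c) <= t * - f a + (1 - t) * - f c.
  exact: (fI T a c (mem_set Ia) (mem_set Ic)).
have bE : t * a + (1 - t) * c = b by rewrite /t; field; lra.
rewrite bE in H.
have : (c - a) * - f b <= (c - a) * (t * - f a + (1 - t) * - f c).
  by rewrite ler_pM2l.
have -> : (c - a) * (t * - f a + (1 - t) * - f c)
  = - ((c - b) * f a + (b - a) * f c).
  by rewrite /t; field; lra.
by rewrite mulrN lerN2.
Qed.

(** The slope [m] is the supremum of the chord slopes to the right of [t0]. By concavity it is at
    most every chord slope to the left, which gives the inequality for t < t0; it is positive
    because [f] exceeds [f t0] somewhere to the right. *)
Lemma concave_tangent {R : realType} (beta : R) (f : R -> R) (t0 : R) :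
  concave_function `]beta, +oo[ f ->
  (forall s t, beta < s -> s <= t -> f s <= f t) ->
  f t @[t --> +oo] --> +oo -> beta < t0 ->
  exists2 m : R, 0 < m & forall t, beta < t -> f t <= f t0 + m * (t - t0).
Proof.
move=> fc fi finf bt0.
have I x : beta < x -> [set` `]beta, +oo[] x by move=> bx; rewrite /= in_itv /= bx.
pose S := [set (f t - f t0) / (t - t0) | t in [set t | t0 < t]].
have ubS s : beta < s -> s < t0 -> ubound S ((f t0 - f s) / (t0 - s)).
  move=> bs st0 _ [t /= t0t <-].
  have := concave_three_points fc (I s bs) (I t (lt_trans bt0 t0t)) st0 t0t.
  rewrite ler_pdivrMr ?subr_gt0 // mulrAC ler_pdivlMr ?subr_gt0 //.
  by nra.
have S0 : S !=set0 by exists ((f (t0 + 1) - f t0) / (t0 + 1 - t0)), (t0 + 1) => //=; lra.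
have Sub : has_ubound S.
  by exists ((f t0 - f ((beta + t0) / 2)) / (t0 - (beta + t0) / 2)); apply: ubS; lra.
have slope t : t0 < t -> f t - f t0 <= sup S * (t - t0).
  move=> t0t; rewrite -ler_pdivrMr ?subr_gt0 //.
  by apply: sup_ubound => //; exists t.
exists (sup S).
  have [M [_ HM]] := (cvgryPgt _).1 finf (f t0).
  pose t := Num.max (M + 1) (t0 + 1).
  have t0t : t0 < t by rewrite /t lt_max; apply/orP; right; lra.
  have : f t0 < f t by apply: HM; rewrite /t lt_max; apply/orP; left; lra.
  have := slope t t0t; rewrite -(@pmulr_lgt0 _ (t - t0)) ?subr_gt0 //.
  by lra.
move=> t bt; have [t0t|tt0|->] := ltgtP t0 t.
- by have := slope t t0t; lra.
- have : sup S <= (f t0 - f t) / (t0 - t) by apply: ge_sup => //; exact: ubS.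
  by rewrite ler_pdivlMr ?subr_gt0 //; lra.
- by rewrite subrr mulr0 addr0.
Qed.

(* The bound of [u] may be infinite at the poles [z1] and [z2], so the maximum
   principle is applied off small balls about them, on whose boundaries the
   harmonic majorant exceeds the maximum of [u] over [K]. *)
Lemma two_pole_bound {R : realType} {k : nat} (D K V : set 'rV[R]_k)
    (u : 'rV[R]_k -> \bar R) (z1 z2 : 'rV[R]_k) (c b q p t m : R) :
  (2 <= k)%N -> subharmonic_on D u -> compact K -> K `<=` D ->
  open V -> V `<=` K -> 0 < c -> 0 < m -> eta_dim k b <= q ->
  (forall y, K y -> c * enorm (y - z1) <= b) ->
  (forall y, K y -> c * enorm (y - z2) <= b) ->
  (forall y, K y -> ~ V y -> y != z1 -> y != z2 ->
     [\/ (u y <= (p + m * (q - t))%:E)%E,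
         (u y <= (p + m * (eta_dim k (c * enorm (y - z1)) - t))%:E)%E |
         (u y <= (p + m * (eta_dim k (c * enorm (y - z2)) - t))%:E)%E]) ->
  forall x, K x -> x != z1 -> x != z2 ->
  (u x <= (p + m * ((eta_dim k (c * enorm (x - z1)) - eta_dim k b) +
                    (eta_dim k (c * enorm (x - z2)) - eta_dim k b) + q - t))%:E)%E.
Proof.
move=> k2 u_sub Kc KD Vo VK c0 m0 bq b1 b2 ub x Kx xz1 xz2.
have K0 : K !=set0 by exists x.
have [M0 uM0] : exists M0 : R, forall y, K y -> (u y <= M0%:E)%E.
  have [|y0 Ky0 ymax] := @usc_attains_max R _ K u Kc K0.
    move=> y1 y2 Ky1 Ky2 uy12.
    have := @usc_add_continuous R k D K u (cst 0) y1 y2 u_sub KD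
      (@cst_continuous _ _ _ _) Ky1 Ky2.
    rewrite /cst !adde0 => /(_ uy12) N.
    by near=> y => Ky; have := near N y _ Ky; rewrite adde0; apply.
  have [uf _ _] := u_sub; have := uf y0 (KD y0 Ky0).
  case E : (u y0) => [r||] // _.
  - by exists r => y Ky; rewrite -E ymax.
  - by exists 0 => y Ky; apply: (le_trans (ymax y Ky)); rewrite E leNye.
(* Above this level of eta one pole alone lifts the majorant to [M0], the other one contributing a
   nonnegative amount. *)
have [r1 r10 blow] :=
  @eta_dim_blowup R k k2 ((M0 - p) / m + eta_dim k b - q + t).
have n1 : 0 < enorm (x - z1) by rewrite enorm_gt0 // subr_eq0.
have n2 : 0 < enorm (x - z2) by rewrite enorm_gt0 // subr_eq0.
(* Small enough for eta to reach that level within [r0] of a pole, and for [x] to stay outside the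
   open balls of radius [r0] about the poles. *)
pose r0 := Num.min (r1 / c) (Num.min (enorm (x - z1)) (enorm (x - z2))).
have r00 : 0 < r0 by rewrite !lt_min n1 n2 divr_gt0.
have r0r1 : c * r0 <= r1 by rewrite mulrC -ler_pdivlMr // ge_min lexx.
have r0n1 : r0 <= enorm (x - z1) by rewrite !ge_min lexx orbT.
have r0n2 : r0 <= enorm (x - z2) by rewrite !ge_min lexx !orbT.
pose far z := [set y : 'rV[R]_k | r0 <= enorm (y - z)].
pose far' z := [set y : 'rV[R]_k | r0 < enorm (y - z)].
have far_closed z : closed (far z).
  rewrite (_ : far z = (fun y => enorm (y - z)) @^-1` [set e | r0 <= e]) //.
  by apply: closed_comp => [y _|]; [exact: continuous_enorm | exact: closed_ge].
have far'_open z : open (far' z).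
  rewrite (_ : far' z = (fun y => enorm (y - z)) @^-1` [set e | r0 < e]) //.
  by apply: open_comp => [y _|]; [exact: continuous_enorm | exact: open_gt].
have far_neq z y : far z y -> y != z.
  rewrite /far /=; apply: contraPneq => ->.
  by rewrite subrr enorm0 leNgt r00.
pose K' := K `&` (far z1 `&` far z2).
pose V' := V `&` (far' z1 `&` far' z2).
have K'c : compact K'.
  apply: (@subclosed_compact _ K' K) => //; last by move=> y [].
  apply: closedI; first by apply: compact_closed => //; exact: norm_hausdorff.
  exact: closedI.
have V'o : open V' by apply: openI => //; exact: openI.
have V'K' : V' `<=` K'.
  by move=> y [Vy [y1 y2]]; split; [exact: VK | split; exact: ltW].
have [h1 [h2 H]] := @eta_dim_harmonic R k k2 c z1 c0.
have [g1 [g2 G]] := @eta_dim_harmonic R k k2 c z2 c0.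
pose b0 := p + m * (q - t - 2 * eta_dim k b).
have V'1 : K' `<=` [set y | y != z1] by move=> y [_ [? _]]; exact: far_neq.
have V'2 : K' `<=` [set y | y != z2] by move=> y [_ [_ ?]]; exact: far_neq.
have J := harmonic_jetD (@harmonic_jet_cst R k K' b0)
  (harmonic_jetD (harmonic_jetZ m (harmonic_jetS V'1 H))
                 (harmonic_jetZ m (harmonic_jetS V'2 G))).
set s := (_ + _ : _ -> R) in J.
have sE y : s y = p + m * ((eta_dim k (c * enorm (y - z1)) - eta_dim k b) +
  (eta_dim k (c * enorm (y - z2)) - eta_dim k b) + q - t).
  have -> : s y = b0 + (m * eta_dim k (c * enorm (y - z1))
    + m * eta_dim k (c * enorm (y - z2))) by [].
  by rewrite /b0; ring.
have scont y : K' y -> {for y, continuous s} by move=> /J [].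
have K'D : K' `<=` D by move=> y [/KD].
rewrite -sE.
apply: (maximum_principle u_sub K'c K'D V'o V'K' scont (harmonic_jetS V'K' J)) => //.
move=> y K'y nV'y; have [Ky [f1 f2]] := K'y.
have y1 := V'1 y K'y; have y2 := V'2 y K'y; rewrite /= in y1 y2.
have pos1 : 0 < c * enorm (y - z1) by rewrite mulr_gt0 // enorm_gt0 // subr_eq0.
have pos2 : 0 < c * enorm (y - z2) by rewrite mulr_gt0 // enorm_gt0 // subr_eq0.
(* Subtracting [eta_dim k b] makes each pole term nonnegative on [K]; with [eta_dim k b <= q], this
   lets [s] dominate each of the three alternatives. *)
have E1 := @eta_dim_le R k _ _ pos1 (b1 y Ky).
have E2 := @eta_dim_le R k _ _ pos2 (b2 y Ky).
have pole (e1 e2 : R) : 0 < e1 -> e1 <= r1 -> eta_dim k b <= e2 ->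
    M0 <= p + m * ((eta_dim k e1 - eta_dim k b) + (e2 - eta_dim k b) + q - t).
  move=> e10 e1r e2b; have B := blow e1 e10 e1r.
  rewrite -lerBlDl mulrC -ler_pdivrMr //; lra.
have [n1y|n1y] := leP (enorm (y - z1)) r0.
  apply: (le_trans (uM0 y Ky)); rewrite lee_fin sE; apply: pole => //.
  by apply: le_trans r0r1; rewrite ler_pM2l.
have [n2y|n2y] := leP (enorm (y - z2)) r0.
  apply: (le_trans (uM0 y Ky)); rewrite lee_fin sE.
  rewrite [_ - _ + _]addrC; apply: pole => //.
  by apply: le_trans r0r1; rewrite ler_pM2l.
have nVy : ~ V y by move=> Vy; apply: nV'y; split.
by have [uy|uy|uy] := ub y Ky nVy y1 y2; apply: (le_trans uy);
  rewrite lee_fin sE lerD2l ler_pM2l //; lra.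
Unshelve. all: by end_near. Qed.

(** * Orthogonal changes of coordinates *)

Section Coordinates.
Context {R : realType} {d : nat}.
Implicit Types (x y : 'rV[R]_(1 + d)) (U : 'M[R]_(1 + d)).

Lemma enorm_orthogonal U x : U *m U^T = 1%:M -> enorm (x *m U^T) = enorm x.
Proof.
move=> UU; have sqE (v : 'rV[R]_(1 + d)) : sqnorm v = (v *m v^T) 0 0.
  by rewrite mxE; apply: eq_bigr => i _; rewrite mxE expr2.
rewrite /enorm; congr Num.sqrt; rewrite -!/(sqnorm _) !sqE.
by rewrite trmx_mul trmxK -mulmxA (mulmxA U^T) (mulmx1C UU) mul1mx.
Qed.

Lemma sqnorm_split x : sqnorm x = lsubmx x 0 0 ^+ 2 + sqnorm (rsubmx x).
Proof.
rewrite /sqnorm big_split_ord /= big_ord1 !mxE; congr (_ + _).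
by apply: eq_bigr => i _; rewrite mxE.
Qed.

Lemma lsubmxB_row x (s : R) (v : 'rV[R]_d) :
  lsubmx (x - row_mx s%:M v) 0 0 = lsubmx x 0 0 - s.
Proof.
have -> : lsubmx (x - row_mx s%:M v) = lsubmx x - s%:M by rewrite linearB /= row_mxKl.
by rewrite mxE; congr (_ + _); rewrite mxE; congr (- _); rewrite mxE eqxx.
Qed.

Lemma rsubmxB_row x (s : R) (v : 'rV[R]_d) :
  rsubmx (x - row_mx s%:M v) = rsubmx x - v.
Proof. by rewrite linearB /= row_mxKr. Qed.

Lemma lsubmx_le_enorm x : `|lsubmx x 0 0| <= enorm x.
Proof. by rewrite mxE coord_le_enorm. Qed.

Lemma rsubmx_le_enorm x : enorm (rsubmx x) <= enorm x.
Proof.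
by apply: ler_wsqrtr; rewrite -!/(sqnorm _) sqnorm_split lerDr sqr_ge0.
Qed.

Lemma enorm_le_split x : enorm x <= `|lsubmx x 0 0| + enorm (rsubmx x).
Proof.
rewrite -(@ler_pXn2r _ 2) ?nnegrE ?addr_ge0 ?enorm_ge0 // sqr_enorm.
rewrite sqnorm_split sqrrD real_normK ?num_real // sqr_enorm.
rewrite lerD2r lerDl mulrn_wge0 // mulr_ge0 ?enorm_ge0 //.
Qed.

Lemma continuous_lsubmx_mul (a : 'rV[R]_(1 + d)) (M : 'M[R]_(1 + d)) :
  continuous (fun y => lsubmx ((y - a) *m M) 0 0).
Proof.
move=> x; rewrite (_ : (fun y => _) =
  (fun y => \sum_j (y - a) 0 j * M j (lshift d 0))).
  apply: (@cvg_big _ _ _ _ _ add_continuous _ (nbhs x)) => i _.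
  by apply: continuousM; [exact: continuous_coordB | exact: cst_continuous].
by apply/funext => y; rewrite !mxE.
Qed.

End Coordinates.

(** * Local geometry of a Lipschitz curve and the bound near it *)

Section LipschitzChart.
Context {R : realType} {d : nat}.
Variables (Gamma : set 'rV[R]_(1 + d)) (a : 'rV[R]_(1 + d)) (L r : R).
Variables (phi : R -> 'rV[R]_d) (U : 'M[R]_(1 + d)).
Hypotheses (L0 : 0 < L) (r0 : 0 < r) (Gamma_a : Gamma a).
Hypothesis phi_lip : forall s t, s \in `]-r, r[ -> t \in `]-r, r[ ->
  enorm (phi s - phi t) <= L * `|s - t|.
Hypothesis UU : U *m U^T = 1%:M.
Hypothesis chart :
  cylinder r (3 * L * r) `&` [set (y - a) *m U^T | y in Gamma] = graph_on r phi.

(** Chart coordinates centred at [a]: [X] runs along the axis over which the curve is a graph, [Y]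
    is transversal to it. *)
Let X (y : 'rV[R]_(1 + d)) : R := lsubmx ((y - a) *m U^T) 0 0.
Let Y (y : 'rV[R]_(1 + d)) := rsubmx ((y - a) *m U^T).

Lemma enorm_chart (y z : 'rV[R]_(1 + d)) :
  enorm ((y - a) *m U^T - (z - a) *m U^T) = enorm (y - z).
Proof. by rewrite -mulmxBl enorm_orthogonal // opprB addrA subrK. Qed.

(** The point [a] of the curve is sent to the origin, which therefore lies on the graph, necessarily
    over the parameter 0. *)
Lemma chart_origin : phi 0 = 0.
Proof.
have : graph_on r phi 0.
  rewrite -chart; split; last by exists a => //; rewrite subrr mul0mx.
  split; first by rewrite mxE mxE oppr_lt0 r0.
  rewrite /eball /= subr0; apply: (le_lt_trans (rsubmx_le_enorm _)).
  by rewrite enorm0 !mulr_gt0.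
move=> [t _]; rewrite -[X in _ = X](@row_mx0 _ 1 1 d) => /eq_row_mx[t0 p0].
suff <- : t = 0 by [].
by move/matrixP/(_ 0 0): t0; rewrite !mxE eqxx.
Qed.

Lemma chart_height (rho : R) : 0 < rho -> rho < r ->
  forall s, `|s| <= rho -> enorm (phi s) <= L * rho.
Proof.
move=> rho0 rhor s srho; rewrite -[phi s]subr0 -chart_origin.
apply: (@le_trans _ _ (L * `|s - 0|)).
  apply: phi_lip; rewrite in_itv /= -ltr_norml ?normr0 //.
  exact: le_lt_trans rhor.
by rewrite subr0 ler_pM2l.
Qed.

(** If [w] lies in the chart, it is (t, phi t) there, and passing from [phi t] to [phi (X y)] costs
    at most L |X y - t|. Otherwise |w - a| >= (L + 4) rho, so |y - w| >= 2 rho, while the gap is at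
    most (L + 2) rho + L rho. *)
Lemma vertical_gap_le (rho : R) (y w : 'rV[R]_(1 + d)) : 0 < rho -> rho < r ->
  (L + 4) * rho <= Num.min r (3 * L * r) ->
  `|X y| <= rho -> enorm (y - a) <= (L + 2) * rho -> Gamma w ->
  enorm (Y y - phi (X y)) <= (1 + L) * enorm (y - w).
Proof.
move=> rho0 rhor rhok Xy ya Gw.
set W := (w - a) *m U^T.
have yw : enorm ((y - a) *m U^T - W) = enorm (y - w) by exact: enorm_chart.
have Xr : X y \in `]-r, r[ by rewrite in_itv /= -ltr_norml (le_lt_trans Xy).
have [cW|ncW] := pselect (cylinder r (3 * L * r) W).
  have : graph_on r phi W by rewrite -chart; split=> //; exists w.
  move=> [t tr WE].
  have dt : `|X y - t| <= enorm (y - w).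
    rewrite -yw; apply: le_trans (lsubmx_le_enorm _).
    by rewrite -WE lsubmxB_row.
  have dY : enorm (Y y - phi t) <= enorm (y - w).
    rewrite -yw; apply: le_trans (rsubmx_le_enorm _).
    by rewrite -WE rsubmxB_row.
  apply: (le_trans (enormB_trans (phi t) _ _)).
  have := phi_lip tr Xr; rewrite distrC => lip.
  have : L * `|X y - t| <= L * enorm (y - w) by rewrite ler_pM2l.
  by lra.
have Wk : Num.min r (3 * L * r) <= enorm W.
  rewrite ge_min; apply: contrapT => /negP; rewrite negb_or -!ltNge => /andP[W1 W2].
  apply: ncW; split.
    by rewrite -ltr_norml; apply: le_lt_trans (lsubmx_le_enorm _) W1.
  by rewrite /eball /= subr0; apply: le_lt_trans (rsubmx_le_enorm _) W2.
have h1 := chart_height rho0 rhor Xy.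
have h2 : enorm (Y y) <= (L + 2) * rho.
  apply: (le_trans (rsubmx_le_enorm _)); by rewrite enorm_orthogonal.
have h3 : enorm (Y y - phi (X y)) <= enorm (Y y) + enorm (phi (X y)).
  by rewrite -(enormN (phi _)) enormD.
have h4 : enorm W <= enorm (y - w) + (L + 2) * rho.
  have : enorm (w - a) <= enorm (w - y) + enorm (y - a) by exact: enormB_trans.
  by rewrite /W enorm_orthogonal // (enormC w y); lra.
have h5 : 2 * rho <= enorm (y - w) by lra.
have : (1 + L) * (2 * rho) <= (1 + L) * enorm (y - w).
  by rewrite ler_pM2l // addr_gt0.
by lra.
Qed.

(* The region is the part of the ball of radius [(L + 2) rho] about [a] lying
   in the slab [|X| < rho]: on the spherical part of its boundary the curve is
   at distance at least [rho / (1 + L)], and each of the two flat parts meets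
   the curve at a single point, where the pole is put. *)
Lemma bound_near_curve (D : set 'rV[R]_(1 + d)) u (rho p m t : R) :
  (2 <= 1 + d)%N -> subharmonic_on D u -> 0 < rho -> rho < r ->
  (L + 4) * rho <= Num.min r (3 * L * r) ->
  ecball a ((L + 2) * rho) `<=` D -> 0 < m ->
  (forall y e, ecball a ((L + 2) * rho) y -> 0 < e -> e <= (L + 3) * rho ->
     (forall w, Gamma w -> e <= enorm (y - w)) ->
     (u y <= (p + m * (eta_dim (1 + d) e - t))%:E)%E) ->
  forall x c, enorm (x - a) <= rho / 2 -> c = (2 * (1 + L))^-1 ->
  (u x <= (p + m * (2 * (eta_dim (1 + d) (c / 2 * rho)
      - eta_dim (1 + d) (c * (2 * L + 3) * rho))
      + eta_dim (1 + d) (c * rho) - t))%:E)%E.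
Proof.
move=> k2 u_sub rho0 rhor rhok aD m0 ub x c xa cV.
have L1 : 0 < 2 * (1 + L) by rewrite mulr_gt0 // addr_gt0.
have cE : c * (2 * (1 + L)) = 1 by rewrite cV mulVf // gt_eqF.
have c0 : 0 < c by rewrite cV invr_gt0.
have cL : 0 < c * L by rewrite mulr_gt0.
(* Points of [K] are within (L + 2) rho of [a] and the poles within (1 + L) rho, whence the factor 2
   L + 3. *)
set b := c * (2 * L + 3) * rho.
set k := (1 + d)%N in k2 *.
(* The point of the curve over the parameter [s]; the poles are [z rho] and [z (- rho)]. *)
pose z s := row_mx s%:M (phi s) *m U + a.
have zE s : (z s - a) *m U^T = row_mx s%:M (phi s).
  by rewrite /z addrK -mulmxA UU mulmx1.
have Xz s y : `|X y - s| <= enorm (y - z s).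
  rewrite -enorm_chart zE; apply: le_trans (lsubmx_le_enorm _).
  by rewrite lsubmxB_row.
have zX s y : X y = s -> enorm (y - z s) <= enorm (Y y - phi (X y)).
  move=> <-; rewrite -enorm_chart zE; apply: le_trans (enorm_le_split _) _.
  by rewrite lsubmxB_row rsubmxB_row subrr normr0 add0r.
have za s : `|s| <= rho -> enorm (z s - a) <= (1 + L) * rho.
  move=> sr; rewrite -(@enorm_orthogonal _ _ U) // zE.
  apply: (le_trans (enorm_le_split _)); rewrite row_mxKl row_mxKr mxE eqxx mulr1n.
  by have := chart_height rho0 rhor sr; lra.
pose K := ecball a ((L + 2) * rho) `&` [set y | `|X y| <= rho].
pose V := eball a ((L + 2) * rho) `&` [set y | `|X y| < rho].
have cX : continuous (fun y => `|X y|).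
  move=> y; apply: (@continuous_comp _ _ _ X (@Num.norm R R)).
    exact: continuous_lsubmx_mul.
  exact: norm_continuous.
have Kc : compact K.
  apply: (@subclosed_compact _ K (ecball a ((L + 2) * rho))) => //.
  - apply: closedI; first exact: closed_ecball.
    by apply: (@closed_comp _ _ (fun y => `|X y|) [set s | s <= rho]) => [y _|];
      [exact: cX | exact: closed_le].
  - exact: compact_ecball.
  - by move=> y [].
have Vo : open V.
  apply: openI; first exact: open_eball.
  by apply: (@open_comp _ _ (fun y => `|X y|) [set s | s < rho]) => [y _|];
    [exact: cX | exact: open_lt].
have VK : V `<=` K by move=> y [y1 y2]; split; exact: ltW.
have KD : K `<=` D by move=> y [/aD].
have rhoL : 0 < rho * L by rewrite mulr_gt0.
have cr : c * rho <= rho by rewrite ger_pMl // -cE; nra.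
have crL : (c * L) * rho = rho / 2 - c * rho.
  have -> : rho / 2 = c * (2 * (1 + L)) * (rho / 2) by rewrite cE mul1r.
  by field.
have cr0 : 0 < c * rho by rewrite mulr_gt0.
have bE : b = rho + c * rho by rewrite /b; lra.
have bq : eta_dim k b <= eta_dim k (c * rho) by apply: eta_dim_le => //; lra.
have Kz s : `|s| <= rho -> forall y, K y -> c * enorm (y - z s) <= b.
  move=> sr y [ya _]; rewrite /ecball /= in ya.
  have := enormB_trans a y (z s); rewrite (enormC a) => yz.
  have zs := za s sr.
  rewrite /b -mulrA ler_pM2l //; lra.
have rr : `|rho| <= rho by rewrite ger0_norm // ltW.
have rN : `|- rho| <= rho by rewrite normrN.
have xX : `|X x| <= rho / 2.
  apply: le_trans xa; rewrite -(enorm_orthogonal _ UU); exact: lsubmx_le_enorm.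
have Kx : K x by split; rewrite /ecball /=; [nra | lra].
(* The poles lie over rho and -rho, whereas |X x| <= rho / 2. *)
have xz s : `|s| = rho -> rho / 2 <= enorm (x - z s).
  move=> sr; apply: le_trans (Xz s x); rewrite distrC.
  by have := lerB_dist s (X x); lra.
have xzn s : `|s| = rho -> x != z s.
  move=> sr; apply: contraTneq (xz s sr) => ->; rewrite subrr enorm0 -ltNge; lra.
have pr : `|rho| = rho by rewrite gtr0_norm.
have nr : `|- rho| = rho by rewrite normrN.
have := @two_pole_bound R k D K V u (z rho) (z (- rho)) c b (eta_dim k (c * rho))
  p t m k2 u_sub Kc KD Vo VK c0 m0 bq (Kz _ rr) (Kz _ rN) _ x Kx (xzn _ pr) (xzn _ nr).
have pole s : `|s| = rho ->
    eta_dim k (c * enorm (x - z s)) <= eta_dim k (c / 2 * rho).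
  move=> sr; apply: eta_dim_le; first by rewrite !mulr_gt0 //.
  by rewrite -mulrA ler_pM2l // mulrC; exact: xz.
move=> H; apply: le_trans (H _) _; last first.
  rewrite lee_fin lerD2l ler_pM2l //.
  by have := pole _ pr; have := pole _ nr; lra.
move=> y [ya Xy] nVy y1 y2.
have gap w : Gamma w -> c * enorm (Y y - phi (X y)) <= enorm (y - w) / 2.
  move=> Gw; have := vertical_gap_le rho0 rhor rhok Xy ya Gw => gw.
  have : c * enorm (Y y - phi (X y)) <= c * ((1 + L) * enorm (y - w)).
    by rewrite ler_pM2l.
  have -> : c * ((1 + L) * enorm (y - w)) = c * (2 * (1 + L)) * (enorm (y - w) / 2).
    by field.
  by rewrite cE mul1r.
(* On the flat face over [s] the gap bounds the distance to the pole [z s], so this pole alone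
   dominates [u] there. *)
have cap s : `|s| <= rho -> y != z s -> X y = s ->
    (u y <= (p + m * (eta_dim k (c * enorm (y - z s)) - t))%:E)%E.
  move=> sr ys Xs; apply: ub => //.
  - by rewrite mulr_gt0 // enorm_gt0 // subr_eq0.
  - by apply: (le_trans (Kz s sr y _)) => //; lra.
  move=> w Gw; have := gap w Gw; have := enorm_ge0 (y - w).
  have : c * enorm (y - z s) <= c * enorm (Y y - phi (X y)).
    by rewrite ler_pM2l //; exact: zX.
  by lra.
have [Xlt|] := ltP `|X y| rho; last first.
  move=> Xge; have /eqP := le_anti (introT andP (conj Xy Xge)).
  rewrite eqr_norml => /andP[/orP[/eqP|/eqP] E _].
    by apply: Or32; exact: cap.
  by apply: Or33; exact: cap.
apply: Or31; apply: ub => //; first by lra.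
move=> w Gw.
have ya2 : (L + 2) * rho <= enorm (y - a).
  by rewrite leNgt; apply/negP => ylt; apply: nVy.
(* This is why the radius is (L + 2) rho: |X y| takes up at most rho and the height of the curve at
   most L rho. *)
have : rho <= enorm (Y y - phi (X y)).
  have h1 := chart_height rho0 rhor Xy.
  have h2 := enorm_le_split ((y - a) *m U^T).
  rewrite enorm_orthogonal // -/(X y) -/(Y y) in h2.
  have h3 := enormD (Y y - phi (X y)) (phi (X y)); rewrite subrK in h3.
  by lra.
move=> rhoY; have := gap w Gw.
have : c * rho <= c * enorm (Y y - phi (X y)) by rewrite ler_pM2l.
by have := enorm_ge0 (y - w); lra.
Qed.

End LipschitzChart.

(* The dimension is k = 1 + d. *)
Theorem theorem2p3 (R : realType) (d : nat) (hk : (2 <= 1 + d)%N)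
    (Omega A B : set 'rV[R]_(1 + d))
    (Omega_open : open Omega) (Omega_bounded : bounded_set Omega)
    (A_sub : A `<=` Omega) (A_closed : closed A)
    (A_curve : exists2 Gamma : set 'rV[R]_(1 + d),
       lipschitz_curve Gamma & A `<=` Gamma)
    (B_closed : closed B) (B_meets : B `&` Omega !=set0)
    (beta : R) (beta_gt0 : 0 < beta) (psi : R -> R)
    (psi_gt0 : forall t, beta < t -> 0 < psi t)
    (psi_concave : concave_function `]beta, +oo[ psi)
    (psi_incr : forall s t, beta < s -> s <= t -> psi s <= psi t)
    (psi_infty : psi t @[t --> +oo] --> +oo)
    (alpha : R) (alpha_gt0 : 0 < alpha)
    (alpha_small : forall t, 0 < t < alpha -> beta < eta_dim (1 + d) t) :
  let g := fun t : R => psi (eta_dim (1 + d) t) in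
  exists c1 c2 tau : R,
    [/\ 0 < c1, 0 < c2, 0 < tau,
        (* g is evaluated only inside (0, alpha) in the conclusion *)
        c1 * tau <= alpha /\ c2 * tau <= alpha &
        forall u : 'rV[R]_(1 + d) -> \bar R,
          subharmonic_on (Omega `\` B) u ->
          (forall x, Omega x -> 0 < dist x (A `|` B) < alpha ->
             (u x <= (g (dist x (A `|` B)))%:E)%E) ->
          forall x, Omega x -> 0 < dist x B < tau ->
             (u x <= (2 * g (c1 * dist x B) - g (c2 * dist x B))%:E)%E].

Proof.
move=> g; have [Gamma [Gamma_c [L [r [L0 r0 chart]]]] AG] := A_curve.
have Ac : compact A by exact: subclosed_compact A_closed Gamma_c AG.
have [tau0 tau00 A_thick] := compact_thickening Ac Omega_open A_sub.
have L1 : 0 < 1 + L by rewrite addr_gt0.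
have L3 : 0 < 2 * (L + 3) by rewrite mulr_gt0 // addr_gt0.
pose c := (2 * (1 + L))^-1.
have c0 : 0 < c by rewrite invr_gt0 mulr_gt0.
(* With [rho = th * del] this gives (L + 3) rho = del / 2, so the region about [a] stays within del
   / 2 of [x] and misses [B]. *)
pose th := (2 * (L + 3))^-1.
have th0 : 0 < th by rewrite invr_gt0.
have thE : th * (2 * (L + 3)) = 1 by rewrite mulVf // gt_eqF.
have thL : 0 < th * L by rewrite mulr_gt0.
have ca : 0 < c / 2 by rewrite divr_gt0.
have cb : 0 < c * (2 * L + 3) by rewrite mulr_gt0 // addr_gt0 // mulr_gt0.
have [e0 e00 combine] := @eta_dim_combine R _ hk _ _ _ ca cb c0.
(* The bound 1/2 makes c1 [del] at most th del / 2, the threshold separating the two cases below. *)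
pose e := Num.min e0 2^-1.
have e_gt0 : 0 < e by rewrite /e lt_min e00 /= invr_gt0 ltr0n.
have e_half : e <= 2^-1 by rewrite ge_min lexx orbT.
have c1_gt0 : 0 < e * th by rewrite mulr_gt0.
have c1_th : e * th <= th / 2 by rewrite mulrC ler_pM2l.
(* [alpha] keeps the arguments of [g] in range, [tau0] keeps the balls about points of [A] inside
   [Omega], and the last term gives the room in the chart required by [bound_near_curve]. *)
pose tau := Num.min alpha (Num.min tau0 (Num.min r (3 * L * r))).
have tau_gt0 : 0 < tau by rewrite !lt_min alpha_gt0 tau00 r0 !mulr_gt0.
have tau_alpha : tau <= alpha by rewrite ge_min lexx.
have tau_tau0 : tau <= tau0 by rewrite !ge_min lexx orbT.
have tau_r : tau <= Num.min r (3 * L * r).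
  by rewrite /tau; do 2! (rewrite ge_min; apply/orP; right).
have th6 : th <= 6^-1.
  by rewrite lef_pV2 ?posrE //; move: L0; lra.
have c1tau : e * th * tau <= alpha.
  apply: le_trans tau_alpha; rewrite ger_pMl //; lra.
exists (e * th), (e * th), tau; split=> // u u_sub u_le x Ox /andP[dx0 dxt].
set del := dist x B in dx0 dxt *.
have -> : 2 * g (e * th * del) - g (e * th * del) = g (e * th * del) by ring.
have B0 : B !=set0 by have [b [Bb _]] := B_meets; exists b.
have AB0 : A `|` B !=set0 by have [b Bb] := B0; exists b; right.
have delB b : B b -> del <= enorm (x - b) by exact: dist_le.
pose t0 := eta_dim (1 + d) (e * th * del).
have c1del : 0 < e * th * del by rewrite mulr_gt0.
have bt0 : beta < t0.
  apply: alpha_small; rewrite c1del /=.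
  by apply: lt_le_trans c1tau; rewrite ltr_pM2l.
(* If no point of [A] is this close, which includes the case of empty [A], then dist(x, A u B) >= c1
   [del] and the hypothesis on [u] suffices. *)
have [[a Aa xa]|far] := pselect (exists2 a, A a & enorm (x - a) < th * del / 2);
    last first.
  have dle : e * th * del <= dist x (A `|` B).
    apply: dist_ge => // y [Ay|By].
      have : th * del / 2 <= enorm (x - y).
        by rewrite leNgt; apply/negP => xy; apply: far; exists y.
      apply: le_trans; rewrite [leRHS]mulrAC ler_pM2r //.
    apply: le_trans (delB y By); rewrite ger_pMl //; lra.
  have dlt : dist x (A `|` B) < alpha.
    apply: le_lt_trans (lt_le_trans dxt tau_alpha).
    by apply: dist_ge => // y By; apply: dist_le; right.
  have d0 : 0 < dist x (A `|` B) by exact: lt_le_trans dle.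
  apply: (le_trans (u_le x Ox _)); first by rewrite d0.
  rewrite lee_fin; apply: psi_incr; first by apply: alpha_small; rewrite d0.
  exact: eta_dim_le.
have [phi [U [phi_lip UU chartE]]] := chart a (AG a Aa).
(* The tangent touches at [t0], the target value of eta, so it remains to bring the combination of
   eta terms below [t0]. *)
have [m m0 tangent] := concave_tangent psi_concave psi_incr psi_infty bt0.
pose rho := th * del.
have rho0 : 0 < rho by rewrite mulr_gt0.
have rho3 : (L + 3) * rho = del / 2.
  have -> : del / 2 = th * (2 * (L + 3)) * (del / 2) by rewrite thE mul1r.
  by rewrite /rho; field.
have Lrho : 0 < L * rho by rewrite mulr_gt0.
have xa2 : enorm (x - a) <= rho / 2 by exact: ltW.
have dr : del < Num.min r (3 * L * r) by exact: lt_le_trans tau_r.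
have rr : Num.min r (3 * L * r) <= r by rewrite ge_min lexx.
have ball_dist y : ecball a ((L + 2) * rho) y -> enorm (x - y) <= del / 2.
  rewrite /ecball /= enormC => ya; apply: (le_trans (enormB_trans a _ _)).
  by move: xa; rewrite (enormC a) -/rho; lra.
have ballO : ecball a ((L + 2) * rho) `<=` Omega `\` B.
  move=> y ya; have yx := ball_dist y ya; split; last first.
    by move=> /delB; lra.
  by apply: (A_thick a Aa); rewrite /ecball /=; apply: (le_trans ya); lra.
apply: (@le_trans _ _ (psi t0 + m * (2 * (eta_dim (1 + d) (c / 2 * rho)
      - eta_dim (1 + d) (c * (2 * L + 3) * rho))
      + eta_dim (1 + d) (c * rho) - t0))%:E).
  apply: (bound_near_curve L0 r0 (AG a Aa) phi_lip UU chartE hk u_sub rho0 _ _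
    ballO m0) => //; try lra.
  move=> y s ya s0 sle sG; have [Oy _] := ballO y ya; have xy := ball_dist y ya.
  (* [A] lies on the curve, and points of [B] are at least [del] from [x], hence at least del / 2 =
     (L + 3) rho from [y]. *)
  have sd : s <= dist y (A `|` B).
    apply: dist_ge => // w [/AG /sG //|/delB xw].
    by have := enormB_trans y x w; lra.
  have d0 : 0 < dist y (A `|` B) by exact: lt_le_trans sd.
  have dlt : dist y (A `|` B) < alpha.
    apply: (@le_lt_trans _ _ (enorm (y - a))); first by apply: dist_le; left.
    by apply: (le_lt_trans ya); lra.
  apply: (le_trans (u_le y Oy _)); first by rewrite d0.
  rewrite lee_fin; apply: (le_trans (tangent _ _)).
    by apply: alpha_small; rewrite d0.
  by rewrite lerD2l ler_pM2l // lerD2r eta_dim_le.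
rewrite lee_fin gerDl pmulr_rle0 // subr_le0.
apply: (le_trans (combine rho rho0)); apply: eta_dim_le => //.
by rewrite -mulrA ler_pM2r // ge_min lexx.
Qed.
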